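(* Let $\Lambda$ be a finite dimensional algebra over a field, let $0\to A\to B\to C\to0$ be a short exact sequence in $\mathrm{mod}\,\Lambda$, let $k>1$ be an integer and $n$ a nonnegative integer. If $k\text{-}\operatorname{dell}B\le n$ and $(k-1)\text{-}\operatorname{edell}C\le n+1$, then $k\text{-}\operatorname{edell}A\le n$.
   Context: $\mathrm{mod}\,\Lambda$ is the category of finitely generated right $\Lambda$-modules. $\mathbb N$ is the set of nonnegative integers; the infimum of the empty set is $+\infty$. $\Omega M$ is the kernel of a projective cover of $M$, $\Omega^0M=M$, $\Omega^{n+1}M=\Omega(\Omega^nM)$. ''$U$ is a direct summand of $V$ up to projective summands'' means that $U$ is isomorphic to a direct summand of $V\oplus P$ for some projective $P$. For an integer $k\ge1$: $k\text{-}\operatorname{dell}M$ is the infimum of all $n\in\mathbb N$ such that $\Omega^nM$ is a direct summand of $\Omega^{n+k}N$ up to projective summands for some $N\in\mathrm{mod}\,\Lambda$; and $k\text{-}\operatorname{edell}M$ is the infimum of all $n\in\mathbb N$ such that for every integer $k'\ge1$ and every right $\Lambda$-module $X$ of injective dimension $\mathrm{id}\,X=n+k-1+k'$ one has $\mathrm{Ext}_\Lambda^{n+k'}(M,X)=0$. *)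

(* Defs.v *)
From HB Require Import structures.
From mathcomp Require Import all_boot all_order all_algebra all_field.
From mathcomp Require Import boolp classical_sets.

Set Implicit Arguments.
Unset Strict Implicit.
Unset Printing Implicit Defensive.

Import GRing.Theory.
Local Open Scope ring_scope.

(* N with +oo adjoined, as option nat: None is +oo. *)
Definition natbar := option nat.

Definition natbar_le (x y : natbar) : bool :=
  match x, y with
  | _, None => true
  | None, Some _ => false
  | Some m, Some n => (m <= n)%N
  end.

Definition inf_nat (S : set nat) : natbar :=
  if pselect (exists n, `[< S n >]) is left h then Some (ex_minn h) else None.

Lemma inf_nat_le (S : set nat) (n : nat) :
  natbar_le (inf_nat S) (Some n) <-> exists2 m, S m & (m <= n)%N.
Proof.
rewrite /inf_nat; case: pselect => [h|noS] /=.
  case: ex_minnP => m /asboolP Sm minm; split=> [le_mn | [p Sp le_pn]].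
    by exists m.
  by apply: leq_trans le_pn; apply: minm; apply/asboolP.
by split=> // -[m Sm _]; case: noS; exists m; apply/asboolP.
Qed.

(* The category of right L-modules is that of left modules over the converse  *)
(* ring L^c: for v in M and a in L, the product v a is written a *: v.        *)
Notation rmodType L := (lmodType (L^c)).

Section Modules.
Variable R : pzRingType.
Implicit Types (U V W K M N X P : lmodType R).

Definition fin_gen M : Prop :=
  exists (n : nat) (g : 'I_n -> M),
    forall x : M, exists a : 'I_n -> R, x = \sum_(i < n) a i *: g i.

Definition surj U V (f : U -> V) : Prop := forall y, exists x, f x = y.

Definition exact_at U V W (f : {linear U -> V}) (g : {linear V -> W}) : Prop :=
  forall y : V, g y = 0 <-> exists x : U, f x = y.

Definition short_exact U V W (f : {linear U -> V}) (g : {linear V -> W}) :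
    Prop :=
  [/\ injective f, exact_at f g & surj g].

Definition lmod_iso U V : Prop := exists f : {linear U -> V}, bijective f.

Definition projective P : Prop :=
  forall U V (g : {linear U -> V}) (f : {linear P -> V}), surj g ->
    exists h : {linear P -> U}, forall x, g (h x) = f x.

Definition injective_mod X : Prop :=
  forall U V (i : {linear U -> V}) (f : {linear U -> X}), injective i ->
    exists h : {linear V -> X}, forall x, h (i x) = f x.

Definition submodule M (S : set M) : Prop :=
  S 0 /\ forall (a : R) (u v : M), S u -> S v -> S (a *: u + v).

(* S is superfluous in M: no proper submodule T of M satisfies T + S = M. *)
Definition superfluous M (S : set M) : Prop :=
  forall T : set M, submodule T ->
    (forall x, exists2 y, T y & S (x - y)) -> forall x, T x.

Definition proj_cover P M (f : {linear P -> M}) : Prop :=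
  [/\ projective P, surj f & superfluous [set x | f x = 0]].

(* Syzygies are determined only up to isomorphism, so they are given as       *)
(* relations: [syzygy M K] says that K is (isomorphic to) Omega M, and        *)
(* [nsyzygy n M K] that K is (isomorphic to) Omega^n M.                       *)
Definition syzygy M K : Prop :=
  exists (P : lmodType R) (f : {linear P -> M}) (i : {linear K -> P}),
    [/\ proj_cover f, injective i & exact_at i f].

Fixpoint nsyzygy (n : nat) M K : Prop :=
  if n is m.+1 then exists2 K' : lmodType R, nsyzygy m M K' & syzygy K' K
  else lmod_iso M K.

Definition direct_summand U V : Prop :=
  exists W : lmodType R, lmod_iso (U * W)%type V.

Definition summand_up_to_proj U V : Prop :=
  exists2 P : lmodType R, projective P & direct_summand U (V * P)%type.

Definition proj_resolution M (P : nat -> lmodType R)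
    (d : forall i, {linear P i.+1 -> P i}) (e : {linear P 0%N -> M}) : Prop :=
  [/\ forall i, projective (P i), surj e, exact_at (d 0%N) e
    & forall i, exact_at (d i.+1) (d i)].

Definition inj_resolution X (I : nat -> lmodType R)
    (d : forall i, {linear I i -> I i.+1}) (e : {linear X -> I 0%N}) : Prop :=
  [/\ forall i, injective_mod (I i), injective e, exact_at e (d 0%N)
    & forall i, exact_at (d i) (d i.+1)].

(* Cocycles and coboundaries of degree i in the complex Hom(P, X). *)
Definition cocycle (P : nat -> lmodType R)
    (d : forall i, {linear P i.+1 -> P i}) X (i : nat) (f : {linear P i -> X}) :
    Prop :=
  forall x, f (d i x) = 0.

Definition coboundary (P : nat -> lmodType R)
    (d : forall i, {linear P i.+1 -> P i}) X (i : nat) :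
    {linear P i -> X} -> Prop :=
  match i return {linear P i -> X} -> Prop with
  | 0%N => fun f => forall x, f x = 0
  | j.+1 => fun f => exists g : {linear P j -> X}, forall x, f x = g (d j x)
  end.

(* Ext^i(M, X) = 0, where Ext^i(M, X) = H^i(Hom(P, X)) for a projective       *)
(* resolution P of M.                                                         *)
Definition Ext_eq0 (i : nat) M X : Prop :=
  forall (P : nat -> lmodType R) (d : forall j, {linear P j.+1 -> P j})
    (e : {linear P 0%N -> M}), proj_resolution d e ->
  forall f : {linear P i -> X}, cocycle d f -> coboundary d f.

(* The zero module has injective dimension 0 here. *)
Definition inj_dim X : natbar :=
  inf_nat [set m | exists (I : nat -> lmodType R)
    (d : forall i, {linear I i -> I i.+1}) (e : {linear X -> I 0%N}),
    inj_resolution d e /\ forall i, (m < i)%N -> forall x : I i, x = 0].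

Definition dell (k : nat) M : natbar :=
  inf_nat [set n | exists N K L : lmodType R,
    [/\ fin_gen N, nsyzygy n M K, nsyzygy (n + k) N L
      & summand_up_to_proj K L]].

Definition edell (k : nat) M : natbar :=
  inf_nat [set n | forall k' : nat, (1 <= k')%N -> forall X : lmodType R,
    inj_dim X = Some (n + k - 1 + k')%N -> Ext_eq0 (n + k') M X].

End Modules.

(* Main.v *)
Require Import Defs.
From HB Require Import structures.
From mathcomp Require Import all_boot all_order all_algebra all_field.
From mathcomp Require Import boolp freeg zify.

Set Implicit Arguments.
Unset Strict Implicit.
Unset Printing Implicit Defensive.

Import GRing.Theory.
Local Open Scope ring_scope.

(* Fix j > n and X with id X = j + k - 1.  If Omega^m B, with m <= n, is a    *)
(* summand of Omega^(m+k) N up to projectives, then shifting dimensions makes *)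
(* Ext^j(B, X) a summand of Ext^(j+k)(N, X), which vanishes for dimension     *)
(* reasons; and Ext^(j+1)(C, X) = 0 because id X = (j + 1) + (k - 1) - 1.     *)
(* Exactness of Ext^j(B, X) -> Ext^j(A, X) -> Ext^(j+1)(C, X) concludes.      *)
(*   The chases are carried out in Hom(-, I) for an injective resolution I of *)
(* X of minimal length, where no horseshoe lemma is needed, and then compared *)
(* with Ext computed from projective resolutions.                             *)

(** [hom_exact_nsyzygy] turns syzygies into degree shifts, so vanishing above id X passes from N to
    B, and [hom_exact_sub] is the part of the long exact sequence that bounds A by B and C.
    [Ext_balance] is used twice: to read the hypothesis on C in Hom(-, I) and to return the
    conclusion on A to [Ext_eq0]. *)

Section LinearMaps.
Variable R : pzRingType.
Implicit Types (U V W X M P : lmodType R).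

Lemma linear_pack U V (f : U -> V) :
  linear f -> exists g : {linear U -> V}, g =1 f.
Proof.
move=> lin_f; pose f_ := GRing.isLinear.Build _ _ _ _ f lin_f.
by exists (HB.pack_for {linear U -> V} f f_).
Qed.

Lemma lin_sub_eq0 U V (f : {linear U -> V}) x y :
  f x = f y -> f (x - y) = 0.
Proof. by move=> e; rewrite linearB e subrr. Qed.

Lemma lift_inj U V W (i : {linear U -> V}) (h : {linear W -> V}) :
    injective i -> (forall w, exists u, i u = h w) ->
  exists g : {linear W -> U}, forall w, i (g w) = h w.
Proof.
move=> inj_i /choice[g gE].
have [|g' g'E] := @linear_pack W U g.
  by move=> a u v; apply: inj_i; rewrite linearP !gE linearP.
by exists g' => w; rewrite g'E.
Qed.

Lemma descend_surj U V W (q : {linear U -> V}) (h : {linear U -> W}) :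
    surj q -> (forall u, q u = 0 -> h u = 0) ->
  exists g : {linear V -> W}, forall u, g (q u) = h u.
Proof.
move=> /choice[s sE] kerq.
have hE u v : q u = q v -> h u = h v.
  by move/lin_sub_eq0/kerq/eqP; rewrite linearB subr_eq0 => /eqP.
have [|g gE] := @linear_pack V W (h \o s).
  by move=> a u v /=; rewrite -linearP; apply: hE; rewrite linearP !sE.
by exists g => u; rewrite gE; apply: hE; rewrite sE.
Qed.

Lemma lmod_iso_inv U V : lmod_iso U V ->
  exists (f : {linear U -> V}) (g : {linear V -> U}), cancel f g /\ cancel g f.
Proof.
case=> f [g fK gK]; have [|g' g'E] := @linear_pack V U g.
  by move=> a u v; apply: (can_inj fK); rewrite linearP !gK.
by exists f, g'; split=> x; rewrite g'E.
Qed.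

Section Kernel.
Variables (U V : lmodType R) (f : {linear U -> V}).

Definition ker_pred : {pred U} := [pred x | f x == 0].

Lemma ker_pred_submod : submod_closed ker_pred.
Proof.
split=> [|a u v]; rewrite !inE ?linear0// => /eqP fu /eqP fv.
by rewrite linearP fu fv scaler0 addr0.
Qed.
HB.instance Definition _ :=
  GRing.isSubmodClosed.Build R U ker_pred ker_pred_submod.

Definition ker_mod : Type := {x | x \in ker_pred}.
HB.instance Definition _ := SubChoice.on ker_mod.
HB.instance Definition _ := [SubChoice_isSubZmodule of ker_mod by <:].
HB.instance Definition _ := [SubZmodule_isSubLmodule of ker_mod by <:].

Definition ker_incl : {linear ker_mod -> U} := val.

Lemma ker_incl_inj : injective ker_incl.
Proof. exact: val_inj. Qed.

Lemma ker_incl_exact : exact_at ker_incl f.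
Proof.
move=> y; split=> [fy|[[x /eqP fx] <-]//].
have ky : y \in ker_pred by apply/eqP.
by exists (exist _ y ky).
Qed.

End Kernel.

(** Turns exactness into a surjection onto a kernel, the form to which projectivity applies. *)
Lemma exact_corestrict U V W (f : {linear U -> V}) (g : {linear V -> W}) :
    exact_at f g ->
  exists2 f' : {linear U -> ker_mod g},
    surj f' & forall x, ker_incl g (f' x) = f x.
Proof.
move=> fg.
have [|f' f'E] := @lift_inj _ _ _ (ker_incl g) f (@ker_incl_inj _ _ g).
  by move=> u; apply/ker_incl_exact/fg; exists u.
exists f' => // y; have /fg[x fx] : g (ker_incl g y) = 0.
  by apply/ker_incl_exact; exists y.
by exists x; apply: (@ker_incl_inj _ _ g); rewrite f'E.
Qed.

Lemma projective_lift_exact P U V W (f : {linear U -> V}) (g : {linear V -> W})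
    (h : {linear P -> V}) :
    projective P -> exact_at f g -> (forall x, g (h x) = 0) ->
  exists p : {linear P -> U}, forall x, f (p x) = h x.
Proof.
move=> projP fg gh; have [f' f'_surj f'E] := exact_corestrict fg.
have [|h' h'E] := @lift_inj _ _ _ (ker_incl g) h (@ker_incl_inj _ _ g).
  by move=> x; apply/ker_incl_exact.
have [p pE] := projP _ _ f' h' f'_surj.
by exists p => x; rewrite -f'E pE h'E.
Qed.

End LinearMaps.

(** * Hom into an injective resolution and dimension shifting *)

Section InjectiveComplex.
Variables (R : pzRingType) (I : nat -> lmodType R).
Variable d : forall i, {linear I i -> I i.+1}.
Implicit Types (A B C K M N P U V W : lmodType R).

(* When I is an injective resolution of X this says Ext^(j+1)(M, X) = 0: note *)
(* the shift of the index.                                                    *)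
Definition hom_exact (j : nat) M : Prop :=
  forall h : {linear M -> I j.+1}, (forall x, d j.+1 (h x) = 0) ->
  exists g : {linear M -> I j}, forall x, d j (g x) = h x.

Lemma hom_exact_eq0 j M : (forall x : I j.+1, x = 0) -> hom_exact j M.
Proof.
move=> I0 h _; have [|g _] := @linear_pack _ M (I j) (fun=> 0).
  by move=> a u v; rewrite scaler0 addr0.
by exists g => x; rewrite (I0 (d j (g x))) (I0 (h x)).
Qed.

Lemma hom_exact_retract j U V (i : {linear U -> V}) (p : {linear V -> U}) :
  cancel i p -> hom_exact j V -> hom_exact j U.
Proof.
move=> ip exV h dh; have [|g gE] := exV (h \o p); first by move=> x; apply: dh.
by exists (g \o i) => x /=; rewrite gE /= ip.
Qed.

Lemma hom_exact_prod j U V :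
  hom_exact j U -> hom_exact j V -> hom_exact j (U * V)%type.
Proof.
move=> exU exV h dh.
have [|i1 i1E] := @linear_pack _ U (U * V)%type (fun u => (u, 0)).
  by move=> a u v; congr pair; rewrite /= scaler0 addr0.
have [|i2 i2E] := @linear_pack _ V (U * V)%type (fun v => (0, v)).
  by move=> a u v; congr pair; rewrite /= scaler0 addr0.
have [|g1 g1E] := exU (h \o i1); first by move=> x; apply: dh.
have [|g2 g2E] := exV (h \o i2); first by move=> x; apply: dh.
have [|g gE] := @linear_pack _ (U * V)%type (I j) (fun x => g1 x.1 + g2 x.2).
  move=> a u v; rewrite /= !linearP scalerDr -!addrA; congr (_ + _).
  by rewrite addrCA.
exists g => -[u v]; rewrite gE /= linearD g1E g2E /= -linearD i1E i2E.
by congr (h _); congr pair; rewrite /= ?addr0 ?add0r.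
Qed.

Lemma hom_exact_iso j U V : lmod_iso U V -> hom_exact j V <-> hom_exact j U.
Proof.
by case/lmod_iso_inv=> f [g [fK gK]]; split; apply: hom_exact_retract.
Qed.

Lemma hom_exact_summand j U V :
  direct_summand U V -> hom_exact j V -> hom_exact j U.
Proof.
case=> W /hom_exact_iso /[apply].
have [|i iE] := @linear_pack _ U (U * W)%type (fun u => (u, 0)).
  by move=> a u v; congr pair; rewrite /= scaler0 addr0.
have [|p pE] := @linear_pack _ (U * W)%type U fst; first by [].
by apply: (@hom_exact_retract j _ _ i p) => u; rewrite pE iE.
Qed.

Hypothesis dd : forall i, exact_at (d i) (d i.+1).

Lemma d_d i x : d i.+1 (d i x) = 0.
Proof. by apply/dd; exists x. Qed.

Lemma hom_exact_proj j P : projective P -> hom_exact j P.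
Proof. by move=> projP h; apply: projective_lift_exact projP (@dd j). Qed.

Lemma hom_exact_summand_up_to_proj j U V :
  summand_up_to_proj U V -> hom_exact j V -> hom_exact j U.
Proof.
case=> P projP UVP exV; apply: (hom_exact_summand UVP).
exact/hom_exact_prod/hom_exact_proj.
Qed.

Hypothesis injI : forall i, injective_mod (I i).

Section ShortExact.
Variables (A B C : lmodType R) (f : {linear A -> B}) (g : {linear B -> C}).
Hypothesis fg : short_exact f g.

(** By injectivity h extends to h' on B; d h' kills A, so it descends to a cocycle c on C. If c = d
    c', then h' - c' g is a cocycle on B that still restricts to h on A. *)
Lemma hom_exact_sub j : hom_exact j B -> hom_exact j.+1 C -> hom_exact j A.
Proof.
case: fg => inj_f ex_fg surj_g exB exC h dh.
have [h' h'E] := injI h inj_f.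
have [|c cE] := @descend_surj _ _ _ _ g (d j.+1 \o h') surj_g.
  by move=> b /ex_fg[a <-] /=; rewrite h'E dh.
have [|c' c'E] := exC c.
  by move=> z; have [b <-] := surj_g z; rewrite cE /= d_d.
have [|b bE] := exB (h' \- (c' \o g)).
  by move=> x; apply: lin_sub_eq0; rewrite /= c'E cE.
exists (b \o f) => x; rewrite /= bE /= h'E.
by have -> : g (f x) = 0 by [apply/ex_fg; exists x]; rewrite linear0 subr0.
Qed.

(** Pulled back to B, h becomes d p. On A, p = d a; with a extended to a' on B, p - d a' kills A and
    descends to the required map on C. *)
Lemma hom_exact_quot j : hom_exact j A -> hom_exact j.+1 B -> hom_exact j.+1 C.
Proof.
case: fg => inj_f ex_fg surj_g exA exB h dh.
have gf x : g (f x) = 0 by apply/ex_fg; exists x.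
have [|p pE] := exB (h \o g); first by move=> x; apply: dh.
have [|a aE] := exA (p \o f); first by move=> x; rewrite /= pE /= gf linear0.
have [a' a'E] := injI a inj_f.
have [|c cE] := @descend_surj _ _ _ _ g (p \- (d j \o a')) surj_g.
  by move=> b /ex_fg[x <-] /=; rewrite a'E aE subrr.
exists c => z; have [b <-] := surj_g z.
by rewrite cE /= linearB pE /= d_d subr0.
Qed.

End ShortExact.

(** The projective middle term has no higher Ext, so the two chases give the two directions. *)
Lemma hom_exact_syzygy j M K : syzygy M K -> hom_exact j K <-> hom_exact j.+1 M.
Proof.
case=> P [f] [i] [[projP surj_f _] inj_i ex_if].
have ses : short_exact i f by split.
have exP l := @hom_exact_proj l P projP.
by split=> ex; [apply: (hom_exact_quot ses) | apply: (hom_exact_sub ses)].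
Qed.

Lemma hom_exact_nsyzygy n j M K :
  nsyzygy n M K -> hom_exact j K <-> hom_exact (n + j) M.
Proof.
elim: n j K => [|n IHn] j K /=; first exact: hom_exact_iso.
case=> K' MK' K'K; rewrite addSnnS -(IHn _ _ MK').
exact: hom_exact_syzygy.
Qed.

(** * Comparison with Ext from projective resolutions *)

Section Balance.
Variables (X : lmodType R) (e : {linear X -> I 0}).
Hypotheses (inj_e : injective e) (ex_e : exact_at e (d 0)).

Lemma Ext1_balance M (P : nat -> lmodType R)
    (dP : forall i, {linear P i.+1 -> P i}) (eP : {linear P 0%N -> M}) :
    proj_resolution dP eP ->
  (forall f : {linear P 1%N -> X}, cocycle dP f -> coboundary dP f) <->
  hom_exact 0 M.
Proof.
case=> projP surj_eP ex_eP exP.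
have eP_d x : eP (dP 0 x) = 0 by apply/ex_eP; exists x.
have d_e x : d 0 (e x) = 0 by apply/ex_e; exists x.
split=> [ext h dh|exM f cf].
  (* On P 1 the lift p takes values in ker d = X, which gives a cocycle f. If f = g dP, then p - e g
     factors through M. *)
  have [|p pE] := @projective_lift_exact _ _ _ _ _ (d 0) (d 1) (h \o eP)
      (projP 0%N) (@dd 0); first by move=> x; apply: dh.
  have [|f fE] := @lift_inj _ _ _ _ e (p \o dP 0) inj_e.
    by move=> w; apply/ex_e; rewrite /= pE /= eP_d linear0.
  have [|g gE] := ext f.
    move=> x; apply: inj_e; rewrite fE /=.
    have -> : dP 0 (dP 1 x) = 0 by apply/exP; exists x.
    by rewrite !linear0.
  have [|c cE] := @descend_surj _ _ _ _ eP (p \- (e \o g)) surj_eP.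
    by move=> u /ex_eP[x <-] /=; rewrite -gE fE /= subrr.
  exists c => z; have [x <-] := surj_eP z.
  by rewrite cE /= linearB d_e subr0 pE.
have [q surj_q qE] := exact_corestrict ex_eP.
have [|phi phiE] := @descend_surj _ _ _ _ q f surj_q.
  move=> u qu; have /exP[x <-] : dP 0 u = 0 by rewrite -qE qu linear0.
  exact: cf.
have [psi psiE] := injI (e \o phi) (@ker_incl_inj _ _ _ eP).
have [|c cE] := @descend_surj _ _ _ _ eP (d 0 \o psi) surj_eP.
  by move=> u /ker_incl_exact[x <-]; rewrite /= psiE /= d_e.
have [|c' c'E] := exM c.
  by move=> z; have [x <-] := surj_eP z; rewrite cE /= d_d.
have [|g gE] := @lift_inj _ _ _ _ e (psi \- (c' \o eP)) inj_e.
  by move=> w; apply/ex_e/lin_sub_eq0; rewrite /= c'E cE.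
exists g => x; apply: inj_e; rewrite gE /= eP_d linear0 subr0.
by rewrite -qE psiE /= phiE.
Qed.

(** The truncated resolution resolves ker eP, and 0 -> ker eP -> P 0 -> M -> 0 shifts the degree by
    one. As this holds for each resolution, vanishing on one gives vanishing on all. *)
Lemma Ext_balance j M (P : nat -> lmodType R)
    (dP : forall i, {linear P i.+1 -> P i}) (eP : {linear P 0%N -> M}) :
    proj_resolution dP eP ->
  (forall f : {linear P j.+1 -> X}, cocycle dP f -> coboundary dP f) <->
  hom_exact j M.
Proof.
elim: j M P dP eP => [|j IHj] M P dP eP res; first exact: Ext1_balance res.
case: (res) => projP surj_eP ex_eP exP.
have [q surj_q qE] := exact_corestrict ex_eP.
have res' : @proj_resolution _ (ker_mod eP) (fun i => P i.+1)
    (fun i => dP i.+1) q.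
  split=> // y; rewrite -exP -qE; split=> [->|]; first exact: linear0.
  by rewrite -[X in _ = X](linear0 (ker_incl eP)) => /ker_incl_inj.
have ses : short_exact (ker_incl eP) eP.
  by split=> //; [apply: ker_incl_inj | apply: ker_incl_exact].
have exP0 l := @hom_exact_proj l _ (projP 0%N).
have [IH1 IH2] := IHj _ _ _ _ res'.
split=> [ext|ex]; first by apply: (hom_exact_quot ses) => //; apply: IH1.
by apply: IH2; apply: (hom_exact_sub ses).
Qed.

End Balance.

End InjectiveComplex.

(** * Enough projectives, by free modules *)

Section EnoughProjectives.
Variable R : nzRingType.

Section FreeModule.
Variables (K : choiceType) (M : lmodType R) (f : K -> M).

Lemma fglift_linear : linear (fglift f).
Proof.
have fgB := lift_is_additive f.
have fg0 : fglift f 0 = 0 by rewrite -[X in fglift f X](subrr 0) fgB subrr.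
have fgN D : fglift f (- D) = - fglift f D by rewrite -sub0r fgB fg0 sub0r.
have fgD D E : fglift f (D + E) = fglift f D + fglift f E.
  by rewrite -[E in LHS]opprK fgB fgN opprK.
(* By additivity, scalars need checking only on the single terms of D. *)
move=> a D E; rewrite fgD; congr (_ + _); rewrite -(freeg_sumE D).
elim: (dom D) => [|x s IHs]; first by rewrite big_nil scaler0 fg0 scaler0.
rewrite big_cons scalerDr !fgD scalerDr IHs; congr (_ + _).
rewrite liftU scalerA -(liftU f); congr (fglift f _).
by apply/eqP/freeg_eqP => y; rewrite coeffZ !coeffU mulrA.
Qed.

End FreeModule.

Lemma freeg_projective (K : choiceType) : projective {freeg K / R}.
Proof.
move=> U V g f /choice[s sE].
have [h hE] := linear_pack (fglift_linear (fun x => s (f << x >>))).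
exists h => D; rewrite -(freeg_sumE D) !linear_sum /=.
apply: eq_bigr => x _; rewrite hE liftU linearZ sE.
rewrite -linearZ; congr (f _).
by apply/eqP/freeg_eqP => y; rewrite coeffZ !coeffU mul1r.
Qed.

Definition free_cover (M : lmodType R) (D : {freeg M / R}) : M := fglift id D.
HB.instance Definition _ (M : lmodType R) :=
  GRing.isLinear.Build R {freeg M / R} M _ (@free_cover M)
    (fglift_linear (@id M)).

Lemma free_cover_surj (M : lmodType R) : surj (@free_cover M).
Proof. by move=> x; exists << x >>; rewrite /free_cover liftU scale1r. Qed.

Fixpoint free_syzygy (M : lmodType R) (n : nat) : lmodType R :=
  if n is m.+1 then ker_mod (@free_cover (free_syzygy M m)) else M.

(** [Ext_eq0] quantifies over resolutions, so extracting anything from it takes at least one. *)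
Lemma proj_resolution_exists (M : lmodType R) :
  exists (P : nat -> lmodType R) (d : forall i, {linear P i.+1 -> P i})
    (e : {linear P 0%N -> M}), proj_resolution d e.
Proof.
exists (fun i => {freeg (free_syzygy M i) / R}).
exists (fun i => ker_incl (@free_cover (free_syzygy M i))
                   \o @free_cover (free_syzygy M i.+1)).
exists (@free_cover M); split=> [i||y|i y]; first exact: freeg_projective.
- exact: free_cover_surj.
- rewrite (ker_incl_exact (@free_cover M) y); split=> -[x <-].
    by have [z <-] := @free_cover_surj (free_syzygy M 1) x; exists z.
  by exists (@free_cover (free_syzygy M 1) x).
- pose c l := @free_cover (free_syzygy M l).
  have <- : c i.+1 y = 0 <-> (ker_incl (c i) \o c i.+1) y = 0.
    split=> [cy|]; first by rewrite /comp cy linear0.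
    by rewrite -[X in _ = X](linear0 (ker_incl (c i))) => /ker_incl_inj.
  rewrite (ker_incl_exact (c i.+1) y); split=> -[x <-].
    by have [z <-] := @free_cover_surj (free_syzygy M i.+2) x; exists z.
  by exists (c i.+2 x).
Qed.

End EnoughProjectives.

(** * The estimate for A *)

Lemma inj_dim_resolution (R : pzRingType) (X : lmodType R) s :
    inj_dim X = Some s ->
  exists (I : nat -> lmodType R) (d : forall i, {linear I i -> I i.+1})
    (e : {linear X -> I 0%N}),
    inj_resolution d e /\ forall i, (s < i)%N -> forall x : I i, x = 0.
Proof.
move=> idX; have : natbar_le (inj_dim X) (Some s) by rewrite idX /=.
case/inf_nat_le=> m [I] [d] [e] [res I0] le_ms.
by exists I, d, e; split=> // i /(leq_ltn_trans le_ms); apply: I0.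
Qed.

Lemma edell_le_of_dell_edell (R : nzRingType) (A B C : lmodType R)
    (f : {linear A -> B}) (g : {linear B -> C}) (k n : nat) :
    short_exact f g -> (1 < k)%N ->
    natbar_le (dell k B) (Some n) ->
    natbar_le (edell (k - 1) C) (Some n.+1) ->
  natbar_le (edell k A) (Some n).
Proof.
move=> fg k_gt1 /inf_nat_le[m [N] [K] [L] [_ BK NL KL] le_mn].
case/inf_nat_le=> p edC le_pn; apply/inf_nat_le; exists n => // k' k'_gt0 X idX.
case: k' k'_gt0 idX => // j _ idX.
have [I [d [e [[injI inj_e ex_e dd] I0]]]] := inj_dim_resolution idX.
(* Now k' is j + 1 and id X = n + k + j. Index n + j for B becomes n - m + j for Omega^m B and n + k
   + j for N, that is, degree n + k + j + 1, above id X. *)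
have exB : hom_exact d (n + j) B.
  rewrite -(subnKC le_mn) -addnA -(hom_exact_nsyzygy dd injI _ BK).
  apply: (hom_exact_summand_up_to_proj dd KL).
  rewrite (hom_exact_nsyzygy dd injI _ NL); apply: hom_exact_eq0.
  by apply: I0; lia.
have exC : hom_exact d (n + j).+1 C.
  have [P [dP [eP res]]] := proj_resolution_exists C.
  apply/(Ext_balance dd injI inj_e ex_e _ res) => h.
  (* For C take k' = n + j + 2 - p, positive since p <= n + 1; then p + (k - 1) - 1 + k' = id X, and
     k > 1 keeps the truncated subtraction exact. *)
  have ext : Ext_eq0 (n + j).+2 C X.
    have -> : ((n + j).+2 = p + (n + j).+2 - p)%N by lia.
    rewrite -addnBA; last lia.
    by apply: edC; [lia | rewrite idX; congr Some; lia].
  exact: ext res h.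
rewrite addnS => P dP eP res.
exact/(Ext_balance dd injI inj_e ex_e _ res)/(hom_exact_sub dd injI fg).
Qed.

Theorem lemma2p21 (F : fieldType) (Lambda : falgType F)
    (A B C : rmodType Lambda)
    (hA : fin_gen A) (hB : fin_gen B) (hC : fin_gen C)
    (f : {linear A -> B}) (g : {linear B -> C}) (hfg : short_exact f g)
    (k n : nat) (hk : (1 < k)%N)
    (hdell : natbar_le (dell k B) (Some n))
    (hedell : natbar_le (edell (k - 1) C) (Some n.+1)) :
  natbar_le (edell k A) (Some n).
Proof. exact: edell_le_of_dell_edell hfg hk hdell hedell. Qed.
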